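(* Let $K$ be a field, $A=K[x_1,\ldots,x_n]$ and $B=K[y_1,\ldots,y_m]$ polynomial rings in disjoint sets of variables, and $S=A\otimes_K B=K[x_1,\ldots,x_n,y_1,\ldots,y_m]$. Let $I\subset A$ and $J\subset B$ be two proper monomial ideals and let $k\ge1$. The following holds for each of the two definitions of the symbolic powers of an ideal $L$ in a polynomial ring $R$, namely $L^{(h)}=\bigcap_{\mathfrak{P}\in\mathrm{Ass}(L)}(L^hR_{\mathfrak{P}}\cap R)$ and $L^{(h)}=\bigcap_{\mathfrak{P}\in\mathrm{Min}(L)}(L^hR_{\mathfrak{P}}\cap R)$ (the same definition being used for $I$, $J$ and $I+J$). If $\mathfrak{p}\subset A$ and $\mathfrak{q}\subset B$ are two monomial prime ideals such that $\mathfrak{p}+\mathfrak{q}\in\mathrm{Ass}((I+J)^{(k)})$, then $$\mathrm{v}_{\mathfrak{p}+\mathfrak{q}}((I+J)^{(k)})=\min_{\substack{0\le d<k\\ \mathfrak{p}\in\mathrm{Ass}(I^{(k-d)})\\ \mathfrak{q}\in\mathrm{Ass}(J^{(d+1)})}}\bigl(\mathrm{v}_{\mathfrak{p}}(I^{(k-d)})+\mathrm{v}_{\mathfrak{q}}(J^{(d+1)})\bigr),$$ where the minimum is over all integers $d$ satisfying the displayed conditions. In particular, $$\mathrm{v}((I+J)^{(k)})=\min_{\substack{0\le d<k\\ \mathfrak{p}\in\mathrm{Ass}(I^{(k-d)})\\ \mathfrak{q}\in\mathrm{Ass}(J^{(d+1)})\\ \mathfrak{p}+\mathfrak{q}\in\mathrm{Ass}((I+J)^{(k)})}}\bigl(\mathrm{v}_{\mathfrak{p}}(I^{(k-d)})+\mathrm{v}_{\mathfrak{q}}(J^{(d+1)})\bigr),$$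 where the minimum is over all triples $(d,\mathfrak{p},\mathfrak{q})$ satisfying the displayed conditions.
   Context: All polynomial rings carry the standard grading. Let $R=\bigoplus_{d\ge0}R_d$ be a standard graded polynomial ring over $K$ and $L\subset R$ a proper graded ideal; $\mathrm{Ass}(L)$ denotes the set of associated primes of $L$ (i.e. of $R/L$) and $\mathrm{Min}(L)$ the set of minimal primes of $L$. For $f\in R$, $L:f=\{u\in R\mid uf\in L\}$. For $\mathfrak{p}\in\mathrm{Ass}(L)$ the local $\mathrm{v}$-number is $\mathrm{v}_{\mathfrak{p}}(L)=\min\{d\ge 0\mid \exists f\in R_d \text{ with } L:f=\mathfrak{p}\}$, and the $\mathrm{v}$-number is $\mathrm{v}(L)=\min\{d\ge0\mid \exists f\in R_d,\ \mathfrak{p}\in\mathrm{Ass}(L)\text{ with }L:f=\mathfrak{p}\}=\min\{\mathrm{v}_{\mathfrak{p}}(L)\mid\mathfrak{p}\in\mathrm{Ass}(L)\}$. A monomial ideal is an ideal generated by monomials; a monomial prime ideal is a prime ideal that is a monomial ideal. In the definition of symbolic powers, $L^hR_{\mathfrak{P}}\cap R$ denotes the contraction to $R$ of the extension of $L^h$ to the localization $R_{\mathfrak{P}}$. For ideals $I'\subset A$ and $J'\subset B$, the sum $I'+J'$ means $I'S+J'S$, an ideal of $S$.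
   Formalization: I and J are assumed nonzero as well as proper; the claim fails otherwise: for I=0 in K[x], J=(y) in K[y], k=2, p=0, q=(y), the left side is v_(y)((y^2))=1 while the right side is 0 (at d=0). *)

(* Defs.v *)
From HB Require Import structures.
From mathcomp Require Import all_boot all_order all_algebra.
From mathcomp Require Import boolp classical_sets.
From mathcomp Require Import mpoly.

Set Implicit Arguments.
Unset Strict Implicit.
Unset Printing Implicit Defensive.

Import GRing.Theory.

Local Open Scope classical_set_scope.
Local Open Scope ring_scope.

Section Minimum.

Definition is_minimum (D : set nat) (d : nat) : Prop :=
  D d /\ forall e, D e -> (d <= e)%N.

(* The junk value [0] is only used when [D] is empty. *)
Definition set_min (D : set nat) : nat := xget 0%N (is_minimum D).

Lemma set_minP (D : set nat) : D !=set0 -> is_minimum D (set_min D).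
Proof.
move=> [d Dd]; rewrite /set_min; apply: (xgetPex 0%N).
have exD : exists d, (fun d => `[< D d >]) d by exists d; apply/asboolP.
case: (ex_minnP exD) => e /asboolP De le_e.
by exists e; split=> // f Df; apply: le_e; apply/asboolP.
Qed.

End Minimum.

Section Ideals.
Variable R : idomainType.
Implicit Types (L M P I : set R) (f : R) (h : nat).

(* [E] is an ideal of the subring [D] of the commutative ring [T]. *)
Definition is_ideal_of (T : comNzRingType) (D E : set T) : Prop :=
  [/\ E `<=` D, E 0, (forall x y, E x -> E y -> E (x + y))
    & (forall a x, D a -> E x -> E (a * x))].

Definition is_ideal L : Prop := is_ideal_of setT L.

Definition ideal_gen (G : set R) : set R := smallest is_ideal G.

Definition is_proper L : Prop := is_ideal L /\ ~ L 1.

Definition is_prime P : Prop :=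
  is_proper P /\ forall x y, P (x * y) -> P x \/ P y.

Definition colon L f : set R := [set u | L (u * f)].

Definition Ass L : set (set R) :=
  [set P | is_prime P /\ exists f, colon L f = P].

Definition Min L : set (set R) :=
  [set P | [/\ is_prime P, L `<=` P
    & forall Q, is_prime Q -> L `<=` Q -> Q `<=` P -> Q = P]].

Definition ideal_mul L M : set R :=
  ideal_gen [set x | exists a b, [/\ L a, M b & x = a * b]].

Fixpoint ideal_pow L h : set R :=
  if h is h'.+1 then ideal_mul (ideal_pow L h') L else setT.

(* As [R] is a domain, its localization at [P] is realized as the usual
   subring of the field of fractions of [R]. *)
Definition localization P : set {fraction R} :=
  [set z | exists a s, ~ P s /\ z = tofrac a / tofrac s].

(* The extension [L R_P], an ideal of [localization P]. *)
Definition loc_extension P L : set {fraction R} :=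
  smallest (is_ideal_of (localization P)) (@tofrac R @` L).

(* The contraction [L R_P \cap R]. *)
Definition loc_contraction P L : set R :=
  @tofrac R @^-1` loc_extension P L.

Inductive symb_kind := SymbAss | SymbMin.

Definition symb_primes (c : symb_kind) L : set (set R) :=
  match c with SymbAss => Ass L | SymbMin => Min L end.

Definition symb_pow (c : symb_kind) L h : set R :=
  \bigcap_(P in symb_primes c L) loc_contraction P (ideal_pow L h).

End Ideals.

Section Polynomials.
Variable K : fieldType.

Definition is_monomial_ideal n (L : set {mpoly K[n]}) : Prop :=
  exists M : set 'X_{1..n},
    L = ideal_gen [set f | exists2 a, M a & f = 'X_[a]].

(* [0] is [d.-homog] for every [d]. *)
Definition vnum_at n (L p : set {mpoly K[n]}) : nat :=
  set_min [set d : nat |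
    exists f : {mpoly K[n]}, f \is d.-homog /\ colon L f = p].

Definition vnum n (L : set {mpoly K[n]}) : nat :=
  set_min [set d : nat |
    exists (f : {mpoly K[n]}) (p : set {mpoly K[n]}),
      [/\ f \is d.-homog, Ass L p & colon L f = p]].

(* [K[x_1..x_n, y_1..y_m]] is [{mpoly K[n + m]}]: the variables [x_i] come
   first, followed by the [y_j]. *)
Definition inclA n m (f : {mpoly K[n]}) : {mpoly K[n + m]} :=
  f \mPo [tuple 'X_(lshift m i) | i < n].

Definition inclB n m (g : {mpoly K[m]}) : {mpoly K[n + m]} :=
  g \mPo [tuple 'X_(rshift n j) | j < m].

(* [I + J] stands for [I S + J S]. *)
Definition sum_ext n m (I : set {mpoly K[n]}) (J : set {mpoly K[m]}) :
    set {mpoly K[n + m]} :=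
  [set z | exists x y, [/\ ideal_gen (@inclA n m @` I) x,
                           ideal_gen (@inclB n m @` J) y & z = x + y]].

End Polynomials.

(* Main.v *)
Require Import Defs.
From HB Require Import structures.
From mathcomp Require Import all_boot all_order all_algebra.
From mathcomp Require Import boolp classical_sets.
From mathcomp Require Import mpoly.

Set Implicit Arguments.
Unset Strict Implicit.
Unset Printing Implicit Defensive.

Import GRing.Theory.

Local Open Scope classical_set_scope.
Local Open Scope ring_scope.

(** A monomial ideal is determined by the upward closed set of exponents of its
    monomials, and every object of the theorem can be read off from such sets.

    Colons and associated primes.  If [V] is a set of variables and [L] is the
    monomial ideal of an upset [U], then saturating [L] with respect to the
    variables outside [V] gives a monomial ideal modulo which every polynomial
    outside the prime [(V)] is a nonzerodivisor ([sat_cancel]).  It follows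
    that the associated primes of [L] are generated by variables
    ([colon_prime]), that a generator [f] with [L : f = (V)] may be replaced by
    one of its own monomials ([colon_witness]), so that local v-numbers are
    minimal degrees of monomials, and that the contraction of a localization of
    [L] is a saturation ([loc_contraction_mideal]).  Hence symbolic powers are
    monomial ideals, described by exponents in [symb_exp].

    Sums.  In disjoint variables, associated and minimal primes of [I + J] are
    exactly the sums of those of [I] and [J] ([symb_vars_sum]), and the
    ordinary binomial expansion of [(I + J)^k] passes to symbolic powers:
    [(I + J)^(k)] is the sum of the [I^(i) J^(j)] with [i + j = k]
    ([symb_exp_sum]).

    The formula.  The decisive property is that [a + e_i] in [I^(h+1)] implies
    [a] in [I^(h)] ([symb_exp_deriv]): lowering one exponent spoils at most one
    of the [h + 1] factors.  Consequently a monomial [x^a] with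
    [I^(h+1) : x^a = p], where [p] is nonzero since [I] is, already lies
    in [I^(h)] ([witness_pred_l]).  With [i + j + 1 = k], this makes
    [I^(i+1) : x^a = p] and [J^(j+1) : y^b = q] together equivalent to
    [(I + J)^(k) : x^a y^b = p + q] for a suitable splitting [i + j] depending
    on the monomial ([witness_join], [witness_split]); taking minimal degrees
    gives the local formula.  The global one follows because each associated
    prime of [(I + J)^(k)] is such a [p + q], and there is at least one
    associated prime ([symb_vars_exists]). *)

(** * Upsets of exponents *)

Section Exponents.
Variable n : nat.
Implicit Types (U T : set 'X_{1..n}) (a b w : 'X_{1..n}) (V : {set 'I_n}).
Implicit Types (h : nat) (c : symb_kind).

Lemma addmAC a b w : (a + b + w)%MM = (a + w + b)%MM.
Proof. by rewrite -!addmA [(b + w)%MM]addmC. Qed.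

Definition upset U := forall a b, U a -> U (a + b)%MM.

Definition meets V a : bool := [exists i in V, a i != 0%N].

Lemma meetsP V a : reflect (exists2 i, i \in V & a i != 0%N) (meets V a).
Proof. exact: exists_inP. Qed.

Lemma meets0 V : meets V 0%MM = false.
Proof. by apply/meetsP=> -[i _]; rewrite mnm0E. Qed.

Lemma meetsD V a b : meets V (a + b)%MM = meets V a || meets V b.
Proof.
apply/meetsP/orP.
  move=> [i iV]; rewrite mnmDE addn_eq0 negb_and => /orP[] nz.
    by left; apply/meetsP; exists i.
  by right; apply/meetsP; exists i.
by case=> /meetsP[i iV nz]; exists i=> //; rewrite mnmDE addn_eq0 negb_and nz ?orbT.
Qed.

Lemma meets1 V i : meets V U_(i)%MM = (i \in V).
Proof.
apply/meetsP/idP => [[j jV]|iV]; first by rewrite mnm1E; case: (i =P j) => [->|].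
by exists i => //; rewrite mnm1E eqxx.
Qed.

Lemma meetsS V V' a : V \subset V' -> meets V a -> meets V' a.
Proof. by move=> /fintype.subsetP s /meetsP[i /s iV nz]; apply/meetsP; exists i. Qed.

Definition vars_upset V : set 'X_{1..n} := [set a | meets V a].

Lemma vars_upset_up V : upset (vars_upset V).
Proof. by move=> a b; rewrite /vars_upset /= meetsD => ->. Qed.

(** The exponent form of [L : x^a = (V)], where [(V)] is the ideal generated by
    the variables in [V]. *)
Definition witness U V a := forall b, U (a + b)%MM <-> meets V b.

Definition covers U V := forall a, U a -> meets V a.

Definition ass_vars U : set {set 'I_n} := [set V | exists a, witness U V a].

Definition min_vars U : set {set 'I_n} :=
  [set V | covers U V /\ forall V', covers U V' -> V' \subset V -> V' = V].

Definition symb_vars c U :=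
  match c with SymbAss => ass_vars U | SymbMin => min_vars U end.

(** Exponents of the contraction of [L] localized at the prime [(V)]: monomials
    in the variables outside [V] become units. *)
Definition sat V U : set 'X_{1..n} :=
  [set a | exists2 b, ~~ meets V b & U (a + b)%MM].

Fixpoint pow_exp U h : set 'X_{1..n} :=
  if h is h'.+1 then
    [set a | exists u v, [/\ pow_exp U h' u, U v & a = (u + v)%MM]]
  else setT.

Definition symb_exp c U h : set 'X_{1..n} :=
  [set a | forall V, symb_vars c U V -> sat V (pow_exp U h) a].

Lemma witness_covers U V a : upset U -> witness U V a -> covers U V.
Proof. by move=> uU wa u Uu; apply/wa; rewrite addmC; apply: uU. Qed.

Lemma symb_vars_covers c U V : upset U -> symb_vars c U V -> covers U V.
Proof. by move=> uU; case: c => [[a]|[]] //; apply: witness_covers. Qed.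

Lemma sat_up V U : upset U -> upset (sat V U).
Proof.
move=> uU a b [w Vw Uaw]; exists w => //.
by rewrite addmAC; apply: uU.
Qed.

Lemma sat_sub V U T : U `<=` T -> sat V U `<=` sat V T.
Proof. by move=> s a [w Vw /s Tw]; exists w. Qed.

Lemma sub_sat V U : U `<=` sat V U.
Proof. by move=> a Ua; exists 0%MM; rewrite ?meets0 ?addm0. Qed.

Lemma sat_satur V U a w : ~~ meets V w -> sat V U (a + w)%MM -> sat V U a.
Proof.
move=> Vw [w' Vw' Uaw]; exists (w + w')%MM; last by rewrite addmA.
by rewrite meetsD negb_or Vw.
Qed.

(** A polynomial has finitely many monomials, so one common multiplier works for
    all of them. *)
Lemma sat_common V U (s : seq 'X_{1..n}) : upset U ->
  (forall a, a \in s -> sat V U a) ->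
  exists2 w, ~~ meets V w & forall a, a \in s -> U (a + w)%MM.
Proof.
move=> uU; elim: s => [|a s IHs] sP; first by exists 0%MM; rewrite ?meets0.
have [a' a's|w Vw Uw] := IHs; first by apply: sP; rewrite inE a's orbT.
have [|w' Vw' Uw'] := sP a; first by rewrite inE eqxx.
exists (w' + w)%MM => [|b]; first by rewrite meetsD negb_or Vw'.
rewrite inE => /predU1P[->|bs]; first by rewrite addmA; apply: uU.
by rewrite [(w' + w)%MM]addmC addmA; apply: uU; apply: Uw.
Qed.

Lemma pow_exp_up U h : upset U -> upset (pow_exp U h).
Proof.
move=> uU; case: h => [//|h] a b [u [v [Pu Uv ->]]].
by exists u, (v + b)%MM; rewrite addmA; split=> //; apply: uU.
Qed.

Lemma pow_exp_le U i j : upset U -> (i <= j)%N -> pow_exp U j `<=` pow_exp U i.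
Proof.
move=> uU; elim: j => [|j IHj]; first by rewrite leqn0 => /eqP->.
rewrite leq_eqVlt ltnS => /predU1P[->//|/IHj le a [u [v [Pu _ ->]]]].
exact/le/pow_exp_up.
Qed.

Lemma pow_exp_nonempty U h : U !=set0 -> pow_exp U h !=set0.
Proof.
move=> [u Uu]; elim: h => [|h [v Pv]]; first by exists 0%MM.
by exists (v + u)%MM, v, u.
Qed.

Lemma subU1K i a b w : (a + U_(i) = b + w)%MM -> b i != 0%N ->
  exists2 b', (b = b' + U_(i))%MM & (a = b' + w)%MM.
Proof.
move=> E nz; have bE : (b = b - U_(i) + U_(i))%MM by rewrite submK // lep1mP.
exists (b - U_(i))%MM => //; apply: (@addIm _ U_(i)%MM).
by rewrite E [in LHS]bE addmAC.
Qed.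

(** Lowering one exponent of a product of [h + 1] factors affects only one of
    them; the other [h] still divide.  This is the monomial substitute, valid in
    every characteristic, for differentiating elements of a power. *)
Lemma pow_exp_deriv U h i a : upset U ->
  pow_exp U h.+1 (a + U_(i))%MM -> pow_exp U h a.
Proof.
move=> uU; elim: h a => [//|h IHh] a [u [v [Pu Uv E]]].
have [v0|vi] := eqVneq (v i) 0%N; last first.
  have [v' _ ->] := subU1K (etrans E (addmC _ _)) vi.
  by rewrite addmC; apply: pow_exp_up.
have ui : u i != 0%N.
  by move/mnmP/(_ i): E; rewrite !mnmDE v0 addn0 mnm1E eqxx addn1 => <-.
have [u' uE ->] := subU1K E ui; exists u', v; split=> //.
by apply: IHh; rewrite -uE.
Qed.

Lemma symb_exp_up c U h : upset U -> upset (symb_exp c U h).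
Proof. by move=> uU a b Sa V /Sa; apply/sat_up/pow_exp_up. Qed.

Lemma symb_exp0 c U : symb_exp c U 0 = setT.
Proof. by apply/seteqP; split=> // a _ V _; apply: sub_sat. Qed.

Lemma symb_exp_le c U i j : upset U -> (i <= j)%N ->
  symb_exp c U j `<=` symb_exp c U i.
Proof. by move=> uU le a Sa V /Sa; apply/sat_sub/pow_exp_le. Qed.

Lemma symb_exp_nonempty c U h : U !=set0 -> symb_exp c U h !=set0.
Proof.
move=> /(pow_exp_nonempty h)[a Pa]; exists a => V _; exact: sub_sat.
Qed.

Lemma symb_exp_deriv c U h i a : upset U ->
  symb_exp c U h.+1 (a + U_(i))%MM -> symb_exp c U h a.
Proof.
move=> uU Sa V /Sa[w Vw]; rewrite addmAC => /(pow_exp_deriv uU) Pw.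
by exists w.
Qed.

Lemma min_vars_exists U : ~ U 0%MM -> exists V, min_vars U V.
Proof.
move=> U0; pose P (V : {set 'I_n}) : bool := `[< covers U V >].
have PT : P [set: 'I_n]%SET.
  apply/asboolP=> a Ua; apply/meetsP; apply: contra_notP U0 => nex.
  suff -> : 0%MM = a by [].
  apply/mnmP=> i; rewrite mnm0E; apply/esym/eqP; apply: contra_notT nex => nz.
  by exists i.
have [V /minsetP[/asboolP PV Vmin] _] := minset_exists PT.
by exists V; split=> // V' cV'; apply: Vmin; apply/asboolP.
Qed.

(** Minimality of [V] gives an exponent of [U] that meets [V] only in [i]; up to
    the variables outside [V] it is a power of the variable [i]. *)
Lemma min_vars_power U V i : upset U -> min_vars U V -> i \in V ->
  exists N, sat V U (U_(i) *+ N)%MM.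
Proof.
move=> uU [cV Vmin] iV.
have : ~ covers U (V :\ i).
  by move/Vmin => /(_ (subsetDl _ _))/setP/(_ i); rewrite !inE eqxx iV.
move=> /existsNP[u /not_implyP[Uu /negP mu]].
have uV j : j \in V -> j != i -> u j = 0%N.
  move=> jV ji; apply/eqP; apply: contraNT mu => nz.
  by apply/meetsP; exists j => //; rewrite !inE ji.
exists (u i); exists [multinom if j \in V then 0%N else u j | j < n].
  by apply/negP => /meetsP[j jV]; rewrite mnmE jV.
set a := (X in U X); suff -> : a = (u + (a - u))%MM by apply: uU.
rewrite [RHS]addmC submK //; apply/mnm_lepP=> j; rewrite mnmDE mulmnE mnm1E mnmE.
case: eqP => [<-|/eqP ij]; first by rewrite mul1n leq_addr.
by rewrite mul0n add0n; case: ifP => // jV; rewrite uV // eq_sym.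
Qed.

(** By [min_vars_power] the exponents outside the saturation have bounded weight
    on [V].  One of maximal weight is pushed into the saturation by each variable
    of [V], which makes it a witness after a multiplication by variables
    outside [V]. *)
Lemma min_vars_ass U V : upset U -> min_vars U V -> ass_vars U V.
Proof.
move=> uU mV; have [cV _] := mV.
have /choice[N NP] : forall i, exists N, i \in V -> sat V U (U_(i) *+ N)%MM.
  move=> i; have [iV|iV] := boolP (i \in V); last by exists 0%N.
  by have [N] := min_vars_power uU mV iV; exists N.
pose deg a := (\sum_(i in V) a i)%N.
pose P d : bool := `[< exists2 a, ~ sat V U a & deg a = d >].
have exP : exists d, P d.
  exists (deg 0%MM); apply/asboolP; exists 0%MM => // -[w Vw].
  by rewrite add0m => /cV; apply/negP.
have bndP d : P d -> (d <= \sum_(i in V) N i)%N.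
  move=> /asboolP[a nSa <-]; apply: leq_sum => i iV.
  rewrite leqNgt; apply/negP => /ltnW lt; apply: nSa.
  rewrite -[a](@submK _ (U_(i) *+ N i)%MM).
    by rewrite addmC; apply: (sat_up uU); apply: NP.
  apply/mnm_lepP=> j; rewrite mulmnE mnm1E.
  by case: eqP => [<-|]; rewrite ?mul1n.
case: (ex_maxnP exP bndP) => d /asboolP[a nSa degd] dmax.
(* By maximality of the weight of [a]. *)
have Si i : i \in V -> sat V U (a + U_(i))%MM.
  move=> iV; apply: contrapT => nS.
  have /dmax : P (deg (a + U_(i))%MM) by apply/asboolP; exists (a + U_(i))%MM.
  rewrite -degd leqNgt => /negP; apply.
  rewrite /deg (bigD1 i) //= [X in (_ < X)%N](bigD1 i) //=.
  rewrite mnmDE mnm1E eqxx addn1 addSn ltnS leq_add2l.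
  by apply: leq_sum => j _; rewrite mnmDE leq_addr.
have [|w Vw Uw] := @sat_common V U [seq (a + U_(i))%MM | i <- enum V] uU.
  by move=> b /mapP[i]; rewrite mem_enum => iV ->; apply: Si.
exists (a + w)%MM => b; split=> [Ub|/meetsP[i iV nz]].
  apply: contra_notT nSa => Vb; exists (w + b)%MM; last by rewrite addmA.
  by rewrite meetsD negb_or Vw.
have bE : (b = U_(i) + (b - U_(i)))%MM by rewrite addmC submK // lep1mP.
rewrite bE addmA; apply: uU; rewrite addmAC; apply: Uw.
by apply: map_f; rewrite mem_enum.
Qed.

Lemma symb_vars_exists c U : upset U -> ~ U 0%MM -> exists V, symb_vars c U V.
Proof.
move=> uU /min_vars_exists[V mV]; exists V; case: c => //=.
exact: min_vars_ass.
Qed.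

Lemma symb_exp_proper c U h : upset U -> ~ U 0%MM -> ~ symb_exp c U h.+1 0%MM.
Proof.
move=> uU U0 S0; have [V pV] := symb_vars_exists c uU U0.
have [w Vw] := S0 _ pV; rewrite add0m => -[u [v [_ Uv wE]]].
have := symb_vars_covers uU pV Uv; apply/negP.
by apply: contraNN Vw => mv; rewrite wE meetsD mv orbT.
Qed.

(** A nonzero ideal cannot have the zero ideal as a colon, so [V] is not empty
    and a single variable of it pushes [a] into [U]. *)
Lemma witness_nonempty U V a : upset U -> U !=set0 -> witness U V a ->
  exists2 i, i \in V & U (a + U_(i))%MM.
Proof.
move=> uU [u Uu] wa; have /meetsP[i iV _] := witness_covers uU wa Uu.
by exists i => //; apply/wa; rewrite meets1.
Qed.

End Exponents.

(** * Sums in disjoint sets of variables *)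

Section DisjointVariables.
Variables n m : nat.
Implicit Types (U : set 'X_{1..n}) (T : set 'X_{1..m}) (x y : 'X_{1..n + m}).
Implicit Types (a : 'X_{1..n}) (b : 'X_{1..m}).
Implicit Types (V : {set 'I_n}) (W : {set 'I_m}) (c : symb_kind) (h k : nat).

Definition lexp x : 'X_{1..n} := [multinom x (lshift m i) | i < n].
Definition rexp x : 'X_{1..m} := [multinom x (rshift n j) | j < m].
Definition join_exp a b : 'X_{1..n + m} :=
  [multinom match split i with inl j => a j | inr j => b j end | i < n + m].

Lemma join_expK x : join_exp (lexp x) (rexp x) = x.
Proof.
by apply/mnmP=> i; rewrite mnmE -{2}(splitK i); case: (split i) => j /=; rewrite mnmE.
Qed.

Lemma lexp_join a b : lexp (join_exp a b) = a.
Proof. by apply/mnmP=> i; rewrite !mnmE (unsplitK (inl _ i)). Qed.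

Lemma rexp_join a b : rexp (join_exp a b) = b.
Proof. by apply/mnmP=> i; rewrite !mnmE (unsplitK (inr _ i)). Qed.

Lemma lexpD x y : lexp (x + y)%MM = (lexp x + lexp y)%MM.
Proof. by apply/mnmP=> i; rewrite !(mnmE, mnmDE). Qed.

Lemma rexpD x y : rexp (x + y)%MM = (rexp x + rexp y)%MM.
Proof. by apply/mnmP=> i; rewrite !(mnmE, mnmDE). Qed.

Lemma lexp0 : lexp 0 = 0%MM.
Proof. by apply/mnmP=> i; rewrite !mnmE. Qed.

Lemma rexp0 : rexp 0 = 0%MM.
Proof. by apply/mnmP=> i; rewrite !mnmE. Qed.

Lemma exp_eqP x y : lexp x = lexp y -> rexp x = rexp y -> x = y.
Proof. by move=> lE rE; rewrite -(join_expK x) lE rE join_expK. Qed.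

Lemma mdeg_join x : mdeg x = (mdeg (lexp x) + mdeg (rexp x))%N.
Proof.
by rewrite !mdegE big_split_ord; congr addn; apply: eq_bigr => i _; rewrite mnmE.
Qed.

Definition sum_exp U T : set 'X_{1..n + m} := [set x | U (lexp x) \/ T (rexp x)].

Definition join_vars V W : {set 'I_(n + m)} :=
  [set i | match split i with inl j => j \in V | inr j => j \in W end].

Lemma join_varsP (X : {set 'I_(n + m)}) : exists V W, X = join_vars V W.
Proof.
exists [set i | lshift m i \in X]%SET, [set j | rshift n j \in X]%SET.
by apply/setP=> i; rewrite inE -{1}(splitK i); case: (split i) => j; rewrite inE.
Qed.

Lemma meets_join V W x :
  meets (join_vars V W) x = meets V (lexp x) || meets W (rexp x).
Proof.
apply/meetsP/orP => [[i]|].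
  rewrite inE -{2}(splitK i); case: (split i) => j jV nz; [left|right];
  by apply/meetsP; exists j; rewrite ?mnmE.
case=> /meetsP[j jV]; rewrite mnmE => nz.
  by exists (lshift m j); rewrite // inE (unsplitK (inl _ j)).
by exists (rshift n j); rewrite // inE (unsplitK (inr _ j)).
Qed.

Lemma vars_upset_join V W :
  vars_upset (join_vars V W) = sum_exp (vars_upset V) (vars_upset W).
Proof.
by apply/seteqP; split=> x; rewrite /vars_upset /sum_exp /= meets_join => /orP.
Qed.

Lemma sum_exp_up U T : upset U -> upset T -> upset (sum_exp U T).
Proof.
by move=> uU uT x y; rewrite /sum_exp /= lexpD rexpD => -[/uU|/uT]; [left|right].
Qed.

Lemma join_vars_sub V W V' W' :
  (join_vars V W \subset join_vars V' W') = (V \subset V') && (W \subset W').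
Proof.
apply/fintype.subsetP/andP => [s|[/fintype.subsetP sV /fintype.subsetP sW] i].
  split; apply/fintype.subsetP=> j jV.
    by have := s (lshift m j); rewrite !inE (unsplitK (inl _ j)); apply.
  by have := s (rshift n j); rewrite !inE (unsplitK (inr _ j)); apply.
by rewrite !inE; case: (split i) => j; [apply: sV|apply: sW].
Qed.

Lemma join_vars_inj V W V' W' :
  join_vars V W = join_vars V' W' -> V = V' /\ W = W'.
Proof.
move=> E; have := join_vars_sub V W V' W'; have := join_vars_sub V' W' V W.
rewrite E subxx => /esym/andP[s1 s2] /esym/andP[s3 s4].
by split; apply/eqP; rewrite finset.eqEsubset ?s1 ?s2 ?s3 ?s4.
Qed.

Lemma covers_sum U T V W :
  covers (sum_exp U T) (join_vars V W) <-> covers U V /\ covers T W.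
Proof.
split=> [cVW|[cV cW] x]; last first.
  by rewrite meets_join => -[/cV->|/cW->] //; rewrite orbT.
split=> u Uu.
  have := cVW (join_exp u 0%MM); rewrite meets_join lexp_join rexp_join meets0 orbF.
  by apply; left; rewrite lexp_join.
have := cVW (join_exp 0%MM u); rewrite meets_join lexp_join rexp_join meets0.
by apply; right; rewrite rexp_join.
Qed.

Lemma min_vars_sum U T V W :
  min_vars (sum_exp U T) (join_vars V W) <-> min_vars U V /\ min_vars T W.
Proof.
split=> [[/covers_sum[cV cW] VWmin]|[[cV Vmin] [cW Wmin]]].
  split; split=> // X cX sX.
    suff /join_vars_inj[]: join_vars X W = join_vars V W by [].
    by apply: VWmin; [apply/covers_sum|rewrite join_vars_sub sX subxx].
  suff /join_vars_inj[]: join_vars V X = join_vars V W by [].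
  by apply: VWmin; [apply/covers_sum|rewrite join_vars_sub sX subxx].
split; first exact/covers_sum.
move=> X; have [V' [W' ->]] := join_varsP X.
by move=> /covers_sum[/Vmin eV /Wmin eW]; rewrite join_vars_sub => /andP[/eV-> /eW->].
Qed.

Lemma ass_vars_sum U T V W :
  ass_vars (sum_exp U T) (join_vars V W) <-> ass_vars U V /\ ass_vars T W.
Proof.
split=> [[x wx]|[[a wa] [b wb]]]; last first.
  exists (join_exp a b) => x.
  rewrite /sum_exp /= lexpD rexpD lexp_join rexp_join meets_join.
  split=> [[/wa->|/wb->]|/orP[/wa|/wb]] //; rewrite ?orbT //; by [left|right].
have [nU nT] : ~ U (lexp x) /\ ~ T (rexp x).
  have := wx 0%MM; rewrite meets0 addm0 => -[w0 _].
  by split=> Ux; suff : false by []; apply: w0; [left|right].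
split.
  exists (lexp x) => a; have := wx (join_exp a 0%MM).
  rewrite /sum_exp /= lexpD rexpD lexp_join rexp_join meets_join.
  rewrite lexp_join rexp_join meets0 orbF addm0 => <-.
  by split=> [|[]//]; left.
exists (rexp x) => b; have := wx (join_exp 0%MM b).
rewrite /sum_exp /= lexpD rexpD lexp_join rexp_join meets_join.
rewrite lexp_join rexp_join meets0 addm0 => <-.
by split=> [|[]//]; right.
Qed.

Lemma symb_vars_sum c U T V W :
  symb_vars c (sum_exp U T) (join_vars V W) <->
  symb_vars c U V /\ symb_vars c T W.
Proof. by case: c; [apply: ass_vars_sum|apply: min_vars_sum]. Qed.

Lemma pow_exp_sum U T h x : upset U -> upset T ->
  pow_exp (sum_exp U T) h x <->
  exists i j, [/\ (i + j)%N = h, pow_exp U i (lexp x) & pow_exp T j (rexp x)].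
Proof.
move=> uU uT; split.
  elim: h x => [|h IHh] x; first by exists 0%N, 0%N.
  move=> [y [z [/IHh[i [j [<- Pi Pj]]] Uz ->]]]; rewrite lexpD rexpD.
  case: Uz => Uz; [exists i.+1, j|exists i, j.+1]; split.
  - by rewrite addSn.
  - by exists (lexp y), (lexp z).
  - exact: pow_exp_up.
  - by rewrite addnS.
  - exact: pow_exp_up.
  - by exists (rexp y), (rexp z).
elim: h x => [//|h IHh] x [[|i] [j]].
  rewrite add0n => -[-> _ [u [v [Pu Tv xE]]]].
  exists (join_exp (lexp x) u), (join_exp 0%MM v); split.
  - by apply: IHh; exists 0%N, h; rewrite rexp_join.
  - by right; rewrite rexp_join.
  - by apply: exp_eqP; rewrite ?lexpD ?rexpD !(lexp_join, rexp_join) ?addm0.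
rewrite addSn => -[[ijh] [u [v [Pu Uv xE]]] Pj].
exists (join_exp u (rexp x)), (join_exp v 0%MM); split.
- by apply: IHh; exists i, j; rewrite lexp_join rexp_join.
- by left; rewrite lexp_join.
- by apply: exp_eqP; rewrite ?lexpD ?rexpD !(lexp_join, rexp_join) ?addm0.
Qed.

(** Exponents of the sum of all [F i * G j] with [i + j = k]. *)
Definition sum_filtration (F : nat -> set 'X_{1..n}) (G : nat -> set 'X_{1..m}) k :
    set 'X_{1..n + m} :=
  [set x | exists i j, [/\ (i + j)%N = k, F i (lexp x) & G j (rexp x)]].

(** Only the inclusion into the right-hand side needs an idea: each pair of
    primes [V], [W] comes with its own splitting of [h], and one splitting must
    serve all of them.  With [i] the largest symbolic order of the [x]-part, some
    [V] refuses order [i + 1]; paired with this [V], every [W] has to grant order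
    at least [h - i]. *)
Lemma symb_exp_sum c U T h : upset U -> upset T ->
  symb_exp c (sum_exp U T) h = sum_filtration (symb_exp c U) (symb_exp c T) h.
Proof.
move=> uU uT; apply/seteqP; split=> x; last first.
  move=> [i [j [ijh Si Sj]]] X; have [V [W ->]] := join_varsP X.
  move=> /symb_vars_sum[pV pW].
  have [[v Vv Pv] [w Ww Pw]] := (Si _ pV, Sj _ pW).
  exists (join_exp v w); first by rewrite meets_join lexp_join rexp_join negb_or Vv.
  apply/pow_exp_sum => //; exists i, j.
  by rewrite lexpD rexpD lexp_join rexp_join.
move=> Sx; pose P i : bool := `[< (i <= h)%N /\ symb_exp c U i (lexp x) >].
have exP : exists i, P i by exists 0%N; apply/asboolP; rewrite symb_exp0.
have bndP i : P i -> (i <= h)%N by move=> /asboolP[].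
case: (ex_maxnP exP bndP) => i /asboolP[ih Si] imax.
exists i, (h - i)%N; split=> //; first by rewrite subnKC.
have [<-|neq] := eqVneq i h; first by rewrite subnn symb_exp0.
have : ~ symb_exp c U i.+1 (lexp x).
  move=> Si1; have /imax : P i.+1 by apply/asboolP; rewrite ltn_neqAle neq ih.
  by rewrite ltnn.
move=> /existsNP[V /not_implyP[pV nS]] W pW.
have [w] := Sx _ ((symb_vars_sum c U T V W).2 (conj pV pW)).
rewrite meets_join negb_or => /andP[Vw Ww] /(pow_exp_sum _ _ uU uT).
move=> [i' [j [ijh]]]; rewrite lexpD rexpD => Pi' Pj.
exists (rexp w) => //; apply: pow_exp_le Pj => //.
(* The order [i'] of the [x]-part at [V] is at most [i], since [V] refuses [i + 1]. *)
suff le : (i' <= i)%N by rewrite leq_subLR -ijh leq_add2r.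
rewrite leqNgt; apply/negP => lt; apply: nS.
by exists (lexp w) => //; apply: pow_exp_le Pi'.
Qed.

(** [F] and [G] abstract the symbolic powers of [I] and [J]; [F_deriv] and
    [G_deriv] are the property that makes exact orders available. *)
Section Filtrations.
Variables (F : nat -> set 'X_{1..n}) (G : nat -> set 'X_{1..m}).
Hypotheses (F_up : forall h, upset (F h)) (G_up : forall h, upset (G h)).
Hypotheses (F0 : F 0 = setT) (G0 : G 0 = setT).
Hypotheses (F_le : forall i j, (i <= j)%N -> F j `<=` F i)
           (G_le : forall i j, (i <= j)%N -> G j `<=` G i).
Hypotheses (F_nonempty : forall h, F h !=set0) (G_nonempty : forall h, G h !=set0).
Hypotheses (F_deriv : forall h i a, F h.+1 (a + U_(i))%MM -> F h a)
           (G_deriv : forall h j b, G h.+1 (b + U_(j))%MM -> G h b).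

(** Some variable pushes [a] into [F h.+1], and removing it costs at most one
    step of the filtration. *)
Lemma witness_pred_l h V a : witness (F h.+1) V a -> F h a.
Proof.
by move=> /(witness_nonempty (@F_up _) (F_nonempty _))[i _]; apply: F_deriv.
Qed.

Lemma witness_pred_r h W b : witness (G h.+1) W b -> G h b.
Proof.
by move=> /(witness_nonempty (@G_up _) (G_nonempty _))[j _]; apply: G_deriv.
Qed.

(** Here [a] has order exactly [i] and [b] order exactly [j] by
    [witness_pred_l] and [witness_pred_r], so a multiple of the pair has order
    above [i + j] as soon as one of the two orders increases. *)
Lemma witness_join i j V W a b :
  witness (F i.+1) V a -> witness (G j.+1) W b ->
  witness (sum_filtration F G (i + j).+1) (join_vars V W) (join_exp a b).
Proof.
move=> wa wb x; have [Fa Gb] := (witness_pred_l wa, witness_pred_r wb).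
rewrite /sum_filtration /= lexpD rexpD lexp_join rexp_join meets_join; split.
  move=> [i' [j' [ijE Fi Gj]]].
  have [lt|ge] := ltnP i i'; first by rewrite (wa _).1 //; apply: F_le Fi.
  rewrite (wb _).1 ?orbT //; apply: G_le Gj.
  by rewrite -(leq_add2l i') ijE addnS ltnS leq_add2r.
case/orP => [/wa|/wb] h; [exists i.+1, j|exists i, j.+1]; split=> //.
- exact: G_up.
- by rewrite addnS.
- exact: F_up.
Qed.

(** Take for [j] the exact order of the [y]-part.  Moving in the [x]-variables
    alone, membership in the sum is membership in [F i.+1]; once this is known,
    [witness_pred_l] shows that [i] is the order of the [x]-part, and the same
    argument applies to the [y]-variables. *)
Lemma witness_split k V W x :
  witness (sum_filtration F G k.+1) (join_vars V W) x ->
  exists i j, [/\ (i + j)%N = k, witness (F i.+1) V (lexp x)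
                & witness (G j.+1) W (rexp x)].
Proof.
move=> wx.
have nx : ~ sum_filtration F G k.+1 x.
  by have := wx 0%MM; rewrite addm0 meets0 => -[w0 _] /w0.
pose P j : bool := `[< (j <= k.+1)%N /\ G j (rexp x) >].
have exP : exists j, P j by exists 0%N; apply/asboolP; rewrite G0.
have bndP j : P j -> (j <= k.+1)%N by move=> /asboolP[].
case: (ex_maxnP exP bndP) => j /asboolP[jk Gj] jmax.
have {}jk : (j <= k)%N.
  move: jk; rewrite leq_eqVlt ltnS => /predU1P[jE|//]; case: nx.
  by exists 0%N, k.+1; rewrite F0 -jE.
have nGj : ~ G j.+1 (rexp x).
  move=> Gj1; have /jmax : P j.+1 by apply/asboolP.
  by rewrite ltnn.
pose i := (k - j)%N; have ijk : (i + j)%N = k by rewrite subnK.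
have wl : witness (F i.+1) V (lexp x).
  move=> a; have := wx (join_exp a 0%MM).
  rewrite meets_join lexp_join rexp_join meets0 orbF => <-.
  rewrite /sum_filtration /= lexpD rexpD lexp_join rexp_join addm0; split.
    by exists i.+1, j; rewrite addSn ijk.
  move=> [i' [j' [ijE Fi' Gj']]]; apply: F_le Fi'.
  rewrite -(leq_add2r j) addSn ijk -ijE leq_add2l leqNgt.
  by apply/negP => lt; apply: nGj; apply: G_le Gj'.
exists i, j; split=> // b; have := wx (join_exp 0%MM b).
rewrite meets_join lexp_join rexp_join meets0 /= => <-.
rewrite /sum_filtration /= lexpD rexpD lexp_join rexp_join addm0; split.
  by exists i, j.+1; split=> //; [rewrite addnS ijk|apply: witness_pred_l wl].
move=> [i' [j' [ijE Fi' Gj']]]; apply: G_le Gj'.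
rewrite -(leq_add2l i) addnS ijk -ijE leq_add2r leqNgt.
apply/negP => lt; have := wl 0%MM; rewrite addm0 meets0 => -[w0 _].
by suff : false by []; apply: w0; apply: F_le Fi'.
Qed.

End Filtrations.
End DisjointVariables.

(** * Ideals and contractions from localizations *)

Section IdealGeneralities.
Variable R : idomainType.
Implicit Types (L P E G : set R) (f s : R).

Lemma ideal_gen_ideal G : is_ideal (ideal_gen G).
Proof.
split=> // [E [[]]//|x y Gx Gy E EG|a x _ Gx E EG]; have [[_ _ addE mulE] _] := EG.
  by apply: addE; [apply: Gx|apply: Gy].
by apply: mulE => //; apply: Gx.
Qed.

Lemma ideal_sum E (T : eqType) (r : seq T) (A : pred T) (F : T -> R) :
  is_ideal E -> (forall x, x \in r -> A x -> E (F x)) ->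
  E (\sum_(x <- r | A x) F x).
Proof.
move=> [_ E0 addE _]; elim: r => [|x r IHr] EF; first by rewrite big_nil.
rewrite big_cons; have Er : E (\sum_(x <- r | A x) F x).
  by apply: IHr => y yr; apply: EF; rewrite inE yr orbT.
by case: ifP => // Ax; apply: addE => //; apply: EF; rewrite ?inE ?eqxx.
Qed.

Lemma prime_exp P f h : is_prime P -> P (f ^+ h) -> P f.
Proof.
move=> [[_ P1] mulP]; elim: h => [|h IHh]; first by rewrite expr0 => /P1.
by rewrite exprS => /mulP[].
Qed.

Lemma loc_contractionP P L f : is_prime P -> is_ideal L ->
  loc_contraction P L f <-> exists2 s, ~ P s & L (s * f).
Proof.
move=> [[[_ P0 _ _] P1] mulP] iL; have [_ L0 addL mulL] := iL.
have nz s : ~ P s -> tofrac s != 0 :> {fraction R}.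
  by rewrite tofrac_eq0; apply: contra_notN => /eqP->.
have nP s t : ~ P s -> ~ P t -> ~ P (s * t) by move=> ? ? /mulP[].
split=> [|[s Ps Lsf] E [[_ _ _ mulE] LE]]; last first.
  have -> : tofrac f = (tofrac 1 / tofrac s) * tofrac (s * f).
    by rewrite tofrac1 div1r tofracM mulKf // nz.
  by apply: mulE; [exists 1, s|apply: LE; exists (s * f)].
(* The fractions with numerator in [L] already form an ideal of the localization. *)
pose E : set {fraction R} :=
  [set z | exists a s, [/\ ~ P s, L a & z = tofrac a / tofrac s]].
rewrite /loc_contraction /= /loc_extension => /(_ E)[].
  split; first split.
  - by move=> z [a [s [Ps _ ->]]]; exists a, s.
  - by exists 0, 1; split=> //; rewrite tofrac0 mul0r.
  - move=> x y [a [s [Ps La ->]]] [b [t [Pt Lb ->]]].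
    exists (t * a + s * b), (s * t); split; [exact: nP|by apply: addL; apply: mulL|].
    rewrite addf_div ?nz // tofracD !tofracM.
    by rewrite [tofrac t * _]mulrC [tofrac s * tofrac b]mulrC.
  - move=> x y [a [s [Ps ->]]] [b [t [Pt Lb ->]]].
    exists (a * b), (s * t); split; [exact: nP|exact: mulL|].
    by rewrite mulf_div !tofracM.
  - by move=> _ [a La <-]; exists a, 1; split=> //; rewrite tofrac1 divr1.
move=> a [s [Ps La E1]]; exists s => //.
suff -> : s * f = a by [].
apply/eqP; rewrite -tofrac_eq tofracM E1 mulrC divfK //; exact: nz.
Qed.

End IdealGeneralities.

(** * Monomial ideals *)

Section MonomialIdeals.
Variables (K : fieldType) (n : nat).
Implicit Types (U T : set 'X_{1..n}) (a b w : 'X_{1..n}) (V : {set 'I_n}).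
Implicit Types (f g s u : {mpoly K[n]}) (L P E : set {mpoly K[n]}).
Implicit Types (h : nat) (c : symb_kind).

Definition mideal U : set {mpoly K[n]} := [set f | forall a, a \in msupp f -> U a].

Lemma mideal_ideal U : upset U -> is_ideal (mideal U).
Proof.
move=> uU; split=> // [a|f g Uf Ug a /msuppD_le|f g _ Ug a /msuppM_le].
- by rewrite msupp0.
- by rewrite mem_cat => /orP[/Uf|/Ug].
- by move=> /allpairsP[[b d] /= [_ /Ug Ud ->]]; rewrite addmC; apply: uU.
Qed.

Lemma midealX U a : mideal U 'X_[a] <-> U a.
Proof.
split=> [|Ua b]; last by rewrite msuppX inE => /eqP->.
by apply; rewrite msuppX inE.
Qed.

Lemma mideal_mono U T : U `<=` T <-> mideal U `<=` mideal T.
Proof.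
split=> [s f Uf a /Uf/s//|s a]; by rewrite -!midealX; apply: s.
Qed.

Lemma mideal_nonzero U : mideal U <> [set 0] -> U !=set0.
Proof.
move=> Unz; apply: contrapT => U0; apply: Unz; apply/seteqP; split=> [f Uf|_ ->].
  apply: msuppnil0; case E: (msupp f) => [//|a r]; case: U0; exists a.
  by apply: Uf; rewrite E inE eqxx.
by move=> a; rewrite msupp0.
Qed.

Lemma mideal_proper U : ~ mideal U 1 -> ~ U 0%MM.
Proof. by rewrite -mpolyX0; apply: contra_not => /midealX. Qed.

Lemma mideal_min U E : is_ideal E -> (forall a, U a -> E 'X_[a]) -> mideal U `<=` E.
Proof.
move=> iE UE f Uf; rewrite [f]mpolyE; apply: ideal_sum => // a af _.
by case: iE => _ _ _ mulE; rewrite -mul_mpolyC; apply/mulE/UE/Uf.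
Qed.

Lemma monomial_idealP L :
  is_monomial_ideal L <-> exists2 U, upset U & L = mideal U.
Proof.
split=> [[M ->]|[U uU ->]].
  pose U : set 'X_{1..n} := [set a | exists b d, M b /\ a = (b + d)%MM].
  have uU : upset U.
    by move=> a w [b [d [Mb ->]]]; exists b, (d + w)%MM; rewrite addmA.
  exists U => //; apply/seteqP; split.
    apply: smallest_sub; first exact: mideal_ideal.
    by move=> _ [a Ma ->]; apply/midealX; exists a, 0%MM; rewrite addm0.
  apply: mideal_min; first exact: ideal_gen_ideal.
  move=> _ [b [d [Mb ->]]] E [[_ _ _ mulE] ME].
  by rewrite mpolyXD mulrC; apply: mulE => //; apply: ME; exists b.
exists U; apply/seteqP; split.
  by apply: mideal_min => [|a Ua]; [exact: ideal_gen_ideal|move=> E [_]; apply; exists a].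
apply: smallest_sub; first exact: mideal_ideal.
by move=> _ [a Ua ->]; apply/midealX.
Qed.

Definition mpart (A : pred 'X_{1..n}) f : {mpoly K[n]} :=
  \sum_(a <- msupp f | A a) f@_a *: 'X_[a].

Lemma mcoeff_part A f a : (mpart A f)@_a = if A a then f@_a else 0.
Proof.
rewrite raddf_sum /=; case: ifP => Aa; last first.
  rewrite big1_seq // => b /andP[Ab _]; rewrite mcoeffZ mcoeffX.
  case: (b =P a) => [ba|_]; last by rewrite mulr0.
  by move: Aa; rewrite -ba Ab.
have [af|af] := boolP (a \in msupp f).
  rewrite big_mkcond (bigD1_seq a) ?msupp_uniq //= Aa mcoeffZ mcoeffX eqxx mulr1.
  rewrite big1 ?addr0 // => b ba.
  by rewrite mcoeffZ mcoeffX (negbTE ba) mulr0 if_same.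
rewrite big1_seq => [|b /andP[_ bf]]; first by apply/esym/eqP; rewrite mcoeff_eq0.
rewrite mcoeffZ mcoeffX; case: (b =P a) => [ba|_]; last by rewrite mulr0.
by move: af; rewrite -ba bf.
Qed.

Lemma msupp_part A f a : (a \in msupp (mpart A f)) = A a && (a \in msupp f).
Proof. by rewrite !mcoeff_msupp mcoeff_part; case: (A a); rewrite ?eqxx. Qed.

Lemma mpartC A f : f = mpart A f + mpart (predC A) f.
Proof.
apply/mpolyP=> a; rewrite mcoeffD !mcoeff_part /=.
by case: (A a); rewrite ?addr0 ?add0r.
Qed.

(** Polynomials outside the prime [(V)] are nonzerodivisors modulo the
    saturation.  Weigh monomials by their degree in [V].  If no monomial of
    [f'] is in the saturation, the parts [s0] and [f0] of least weight in [s]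
    and [f'], of weights [0] and [d], produce the whole part of weight [d] of
    [s * f'].  Its leading monomial is a monomial of [f0] times one free of [V],
    hence outside the saturation. *)
Lemma sat_cancel U V s f : upset U -> ~ mideal (vars_upset V) s ->
  mideal (sat V U) (s * f) -> mideal (sat V U) f.
Proof.
move=> uU Vs; have uS := sat_up (V := V) uU.
(* Only the monomials of [f] outside the saturation matter. *)
pose inS : pred 'X_{1..n} := fun a => `[< sat V U a >].
rewrite {1}(mpartC inS f) mulrDr => Ssf.
set f' := mpart (predC inS) f in Ssf.
have {Ssf} Ssf : mideal (sat V U) (s * f').
  have [_ _ addS mulS] := mideal_ideal uS.
  rewrite -[s * f'](addKr (s * mpart inS f)) -mulrN; apply: addS => //.
  apply: mulS => // a; rewrite (perm_mem (msuppN _)) msupp_part.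
  by move=> /andP[/asboolP].
have [f'0|nz] := eqVneq f' 0.
  by move=> a; rewrite (mpartC inS f) -/f' f'0 addr0 msupp_part => /andP[/asboolP].
have f'S a : a \in msupp f' -> ~ sat V U a.
  by rewrite msupp_part => /andP[/negP nS _] Sa; apply: nS; apply/asboolP.
pose wt a := (\sum_(i in V) a i)%N.
have wtD a b : wt (a + b)%MM = (wt a + wt b)%N.
  by rewrite -big_split; apply: eq_bigr => i _; rewrite mnmDE.
have wt0 a : ~~ meets V a -> wt a = 0%N.
  move=> Va; apply: big1 => i iV; apply/eqP; apply: contraNT Va => nza.
  by apply/meetsP; exists i.
have wt_gt0 a : meets V a -> (0 < wt a)%N.
  by move=> /meetsP[i iV nza]; rewrite /wt (bigD1 i) //= addn_gt0 lt0n nza.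
pose hasw d := has (fun a => wt a == d) (msupp f').
have exw : exists d, hasw d.
  exists (wt (mlead f')); apply/hasP; exists (mlead f') => //.
  exact: mlead_supp.
case: (ex_minnP exw) => d /hasP[a0 a0f /eqP wa0] dmin.
have {}dmin a : a \in msupp f' -> (d <= wt a)%N.
  by move=> af; apply: dmin; apply/hasP; exists a.
pose s0 := mpart (predC (meets V)) s; pose f0 := mpart (fun a => wt a == d) f'.
have s0nz : s0 != 0.
  apply/eqP => s00; apply: Vs => a aS; apply: contrapT => /negP Va.
  have : a \in msupp s0 by rewrite msupp_part /= Va.
  by rewrite s00 msupp0.
have f0nz : f0 != 0.
  apply/eqP => f00; have : a0 \in msupp f0 by rewrite msupp_part wa0 eqxx.
  by rewrite f00 msupp0.
have /[!msupp_part]/andP[/= Vs0 _] := mlead_supp s0nz.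
have := mlead_supp f0nz; rewrite {2}/f0 msupp_part => /andP[/eqP wf0 f0f].
(* The products other than [s0 * f0] only have monomials of weight above [d]. *)
have lead_in : (mlead s0 + mlead f0)%MM \in msupp (s * f').
  have notin g g' : (forall a b, a \in msupp g -> b \in msupp g' ->
      (d < wt a + wt b)%N) -> (g * g')@_(mlead s0 + mlead f0) = 0.
    move=> lt; apply/eqP; rewrite mcoeff_eq0; apply/negP => /msuppM_le.
    move=> /allpairsP[[a b] /= [ag bg E]]; have := lt _ _ ag bg.
    by rewrite -wtD -E wtD wf0 wt0 // ltnn.
  rewrite mcoeff_msupp (mpartC (predC (meets V)) s) -/s0 mulrDl mcoeffD.
  rewrite [X in _ + X]notin ?addr0; last first.
    move=> a b; rewrite msupp_part /= negbK => /andP[/wt_gt0 wa _] /dmin wb.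
    by rewrite -add1n leq_add.
  rewrite (mpartC (fun a => wt a == d) f') -/f0 mulrDr mcoeffD.
  rewrite [X in _ + X]notin ?addr0; last first.
    move=> a b _; rewrite msupp_part /= => /andP[wb /dmin].
    by rewrite leq_eqVlt eq_sym (negbTE wb) /= => /leq_trans; apply; rewrite leq_addl.
  by rewrite mleadcM mulf_neq0 // mleadc_eq0.
case: (f'S _ f0f); apply: (sat_satur Vs0).
by rewrite addmC; apply: Ssf.
Qed.

Lemma vars_prime V : is_prime (mideal (vars_upset V)).
Proof.
have uV := vars_upset_up (V := V).
split.
  by split; [exact: mideal_ideal|rewrite -mpolyX0 midealX /vars_upset /= meets0].
have satV : sat V (vars_upset V) = vars_upset V.
  apply/seteqP; split=> [a [b Vb]|]; last exact: sub_sat.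
  by rewrite /vars_upset /= meetsD (negbTE Vb) orbF.
move=> f g Vfg; apply: contrapT => /not_orP[Vf]; apply.
by rewrite -satV; apply: (sat_cancel uV Vf); rewrite satV.
Qed.

(** The largest monomial prime inside a prime [P] is generated by these. *)
Definition prime_vars P : {set 'I_n} := [set i | `[< P 'X_i >]]%SET.

Lemma prime_monomial P a : is_prime P -> P 'X_[a] <-> meets (prime_vars P) a.
Proof.
move=> pP; have [[iP P1] mulP] := pP; split=> [|/meetsP[i]].
  rewrite mpolyXE_id => Pa; apply/meetsP; apply: contrapT => nex.
  apply: (big_ind (fun x => ~ P x)) Pa => // [x y Px Py /mulP[]//|i _ Pi].
  apply: nex; exists i; first by rewrite inE; apply/asboolP; apply: prime_exp Pi.
  by apply/eqP => a0; rewrite a0 expr0 in Pi.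
rewrite inE => /asboolP Pi nz; have [_ _ _ mul] := iP.
have -> : a = (a - U_(i) + U_(i))%MM by rewrite submK // lep1mP.
by rewrite mpolyXD; apply: mul.
Qed.

Lemma vars_sub_prime P : is_prime P -> mideal (vars_upset (prime_vars P)) `<=` P.
Proof.
move=> pP; apply: mideal_min; first by case: pP => -[].
by move=> a /(prime_monomial _ pP).
Qed.

Lemma prime_vars_upset V : prime_vars (mideal (vars_upset V)) = V.
Proof.
apply/setP=> i; rewrite inE; apply/asboolP/idP.
  by move=> /midealX; rewrite /vars_upset /= meets1.
by move=> iV; apply/midealX; rewrite /vars_upset /= meets1.
Qed.

Lemma monomial_primeP P : is_monomial_ideal P -> is_prime P ->
  P = mideal (vars_upset (prime_vars P)).
Proof.
move=> /monomial_idealP[U uU PE] pP; apply/seteqP; split.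
  rewrite {1}PE; apply/mideal_mono => a Ua.
  by apply/(prime_monomial _ pP); rewrite PE midealX.
exact: vars_sub_prime.
Qed.

Lemma colonX U f a : mideal U ('X_[a] * f) <-> forall b, b \in msupp f -> U (a + b)%MM.
Proof.
rewrite mulrC; split=> [Uf b bf|Uf b]; last first.
  by rewrite (perm_mem (msuppMX _ _)) => /mapP[b' b'f ->]; apply: Uf.
by apply: Uf; rewrite (perm_mem (msuppMX _ _)) map_f.
Qed.

(** Every monomial of [f] has a colon containing [(V)].  If none had a colon
    inside [(V)], each would be moved into [U] by variables outside [V], and so
    would all at once by [sat_common], contradicting the colon of [f]. *)
Lemma colon_witness U V f : upset U ->
  colon (mideal U) f = mideal (vars_upset V) ->
  exists2 a, a \in msupp f & witness U V a.
Proof.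
move=> uU colE.
have colX b : (forall a, a \in msupp f -> U (b + a)%MM) <-> meets V b.
  rewrite -colonX -[mideal U _]/(colon (mideal U) f 'X_[b]) colE.
  exact: midealX.
apply: contrapT => nex.
have [a af|w Vw Uw] := @sat_common _ V U (msupp f) uU.
  apply: contrapT => nS; apply: nex; exists a => // b; split=> [Ub|/colX/(_ _ af)].
    by apply: contra_notT nS => Vb; exists b.
  by rewrite addmC.
have : meets V w by apply/colX => a /Uw; rewrite addmC.
by rewrite (negbTE Vw).
Qed.

Lemma witness_colon U V a : witness U V a ->
  colon (mideal U) 'X_[a] = mideal (vars_upset V).
Proof.
move=> wa; apply/seteqP; split=> f; rewrite /colon /= mulrC colonX.
  by move=> Uf b /Uf/wa.
by move=> Vf b /Vf Vb; apply/wa.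
Qed.

(** With [V] the variables in [P], an element of [P] outside [(V)] could be
    cancelled from [u * f] in the saturation by [sat_cancel]; then a monomial
    without variables of [V] would multiply [f] into the ideal, so would lie in
    [P]. *)
Lemma colon_prime U P f : upset U -> is_prime P -> colon (mideal U) f = P ->
  P = mideal (vars_upset (prime_vars P)).
Proof.
move=> uU pP colE; set V := prime_vars P.
apply/seteqP; split; last exact: vars_sub_prime.
move=> u Pu; apply: contrapT => Vu.
have Sf : mideal (sat V U) f.
  apply: (sat_cancel uU Vu); move: Pu; rewrite -colE /colon /=.
  by move: (u * f); apply/mideal_mono/sub_sat.
have [w Vw Uw] := sat_common uU Sf.
suff /(prime_monomial _ pP) : P 'X_[w] by rewrite -/V (negbTE Vw).
by rewrite -colE /colon /= colonX => b /Uw; rewrite addmC.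
Qed.

Lemma Ass_mideal U P : upset U ->
  Ass (mideal U) P <-> exists2 V, P = mideal (vars_upset V) & ass_vars U V.
Proof.
move=> uU; split=> [[pP [f colE]]|[V -> [a wa]]].
  have PE := colon_prime uU pP colE; exists (prime_vars P) => //.
  by have [|a _ wa] := @colon_witness U (prime_vars P) f uU; [rewrite -PE|exists a].
by split; [exact: vars_prime|exists 'X_[a]; apply: witness_colon].
Qed.

Lemma Ass_vars U V : upset U ->
  Ass (mideal U) (mideal (vars_upset V)) <-> ass_vars U V.
Proof.
move=> uU; rewrite Ass_mideal //; split=> [[V' E aV']|aV]; last by exists V.
by rewrite -(prime_vars_upset V) E prime_vars_upset.
Qed.

Lemma Min_mideal U P : upset U ->
  Min (mideal U) P <-> exists2 V, P = mideal (vars_upset V) & min_vars U V.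
Proof.
move=> uU; split=> [[pP UP Pmin]|[V -> [cV Vmin]]].
  have PE : P = mideal (vars_upset (prime_vars P)).
    apply/esym/Pmin; [exact: vars_prime| |exact: vars_sub_prime].
    by apply/mideal_mono => a /midealX/UP/(prime_monomial _ pP).
  exists (prime_vars P) => //; split=> [a /midealX/UP/(prime_monomial _ pP)//|V' cV' sV'].
  rewrite -(prime_vars_upset V'); congr prime_vars.
  apply: Pmin; [exact: vars_prime|exact/mideal_mono|rewrite PE; apply/mideal_mono].
  by move=> a; apply: meetsS.
split; [exact: vars_prime|exact/mideal_mono|].
move=> Q pQ UQ QV; have VE : prime_vars Q = V.
  apply: Vmin => [a /midealX/UQ/(prime_monomial _ pQ)//|].
  apply/fintype.subsetP => i; rewrite inE => /asboolP/QV/midealX.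
  by rewrite /vars_upset /= meets1.
by apply/seteqP; split=> //; rewrite -VE; apply: vars_sub_prime.
Qed.

(** * Symbolic powers and v-numbers of monomial ideals *)

Lemma ideal_pow_mideal U h : upset U ->
  ideal_pow (mideal U) h = mideal (pow_exp U h).
Proof.
move=> uU; elim: h => [|h IHh] /=; first by apply/seteqP; split.
have uP := pow_exp_up (h := h.+1) uU.
rewrite IHh; apply/seteqP; split.
  apply: smallest_sub; first exact: mideal_ideal.
  move=> _ [f [g [Pf Ug ->]]] a /msuppM_le/allpairsP[[b d] /= [/Pf Pb /Ug Ud ->]].
  by exists b, d.
apply: mideal_min; first exact: ideal_gen_ideal.
move=> _ [b [d [Pb Ud ->]]] E [_]; apply.
by exists 'X_[b], 'X_[d]; split; [exact/midealX|exact/midealX|rewrite mpolyXD].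
Qed.

Lemma loc_contraction_mideal U V : upset U ->
  loc_contraction (mideal (vars_upset V)) (mideal U) = mideal (sat V U).
Proof.
move=> uU; have iU := mideal_ideal uU; have pV := vars_prime V.
apply/seteqP; split=> f.
  move=> /(loc_contractionP _ pV iU)[s Vs Usf]; apply: (sat_cancel uU Vs).
  by move: (s * f) Usf; apply/mideal_mono/sub_sat.
move=> /(sat_common uU)[w Vw Uw]; apply/(loc_contractionP _ pV iU).
exists 'X_[w]; first by move=> /midealX; rewrite /vars_upset /= (negbTE Vw).
by rewrite colonX => b /Uw; rewrite addmC.
Qed.

Lemma symb_primes_mideal c U P : upset U ->
  symb_primes c (mideal U) P <->
  exists2 V, P = mideal (vars_upset V) & symb_vars c U V.
Proof. by move=> uU; case: c; [apply: Ass_mideal|apply: Min_mideal]. Qed.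

Lemma symb_pow_mideal c U h : upset U ->
  symb_pow c (mideal U) h = mideal (symb_exp c U h).
Proof.
move=> uU; have uP := pow_exp_up (h := h) uU.
apply/seteqP; split=> f; rewrite /symb_pow ideal_pow_mideal //.
  move=> Sf a af V pV.
  have : loc_contraction (mideal (vars_upset V)) (mideal (pow_exp U h)) f.
    by apply: Sf; apply/symb_primes_mideal => //; exists V.
  by rewrite loc_contraction_mideal //; apply.
move=> Sf _ /(symb_primes_mideal _ _ uU)[V -> pV].
by rewrite loc_contraction_mideal // => a /Sf; apply.
Qed.

Lemma Ass_symb c U h V : upset U ->
  Ass (symb_pow c (mideal U) h) (mideal (vars_upset V)) <->
  ass_vars (symb_exp c U h) V.
Proof.
by move=> uU; rewrite symb_pow_mideal //; apply/Ass_vars/symb_exp_up.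
Qed.

Lemma Ass_symb_monomial c U h P : upset U ->
  Ass (symb_pow c (mideal U) h) P -> exists V, P = mideal (vars_upset V).
Proof.
move=> uU; rewrite symb_pow_mideal // => /Ass_mideal[|V -> _]; last by exists V.
exact: symb_exp_up.
Qed.

Lemma vnum_at_le U V a : upset U -> witness U V a ->
  (vnum_at (mideal U) (mideal (vars_upset V)) <= mdeg a)%N.
Proof.
move=> uU wa; have Da : exists f : {mpoly K[n]},
    f \is (mdeg a).-homog /\ colon (mideal U) f = mideal (vars_upset V).
  by exists 'X_[a]; split; [rewrite dhomogX|apply: witness_colon].
by apply: (set_minP _).2 => //; exists (mdeg a).
Qed.

Lemma vnum_atP U V : upset U -> ass_vars U V ->
  exists2 a, witness U V a & mdeg a = vnum_at (mideal U) (mideal (vars_upset V)).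
Proof.
move=> uU [a wa].
have [|[f [fh colE]] _] := @set_minP [set d : nat | exists f : {mpoly K[n]},
    f \is d.-homog /\ colon (mideal U) f = mideal (vars_upset V)].
  by exists (mdeg a), 'X_[a]; split; [rewrite dhomogX|apply: witness_colon].
have [b bf wb] := colon_witness uU colE; exists b => //.
by rewrite (dhomogP _ _ _ fh).
Qed.

Lemma vnum_min U : upset U -> (exists V, ass_vars U V) ->
  is_minimum [set v | exists2 V, ass_vars U V
    & v = vnum_at (mideal U) (mideal (vars_upset V))] (vnum (mideal U)).
Proof.
move=> uU [V0 aV0].
have degP V : ass_vars U V ->
    exists (f : {mpoly K[n]}) (p : set {mpoly K[n]}),
      [/\ f \is (vnum_at (mideal U) (mideal (vars_upset V))).-homog,
          Ass (mideal U) p & colon (mideal U) f = p].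
  move=> aV; have [a wa <-] := vnum_atP uU aV.
  exists 'X_[a], (mideal (vars_upset V)); split; last exact: witness_colon.
    by rewrite dhomogX.
  exact/Ass_vars.
have [|[f [p [fh Ap colE]]] vmin] := @set_minP [set d : nat |
    exists (f : {mpoly K[n]}) (p : set {mpoly K[n]}),
      [/\ f \is d.-homog, Ass (mideal U) p & colon (mideal U) f = p]].
  by exists (vnum_at (mideal U) (mideal (vars_upset V0))); apply: degP.
split=> [|_ [V aV ->]]; last by apply: vmin; apply: degP.
have [V pE aV] := (Ass_mideal p uU).1 Ap; exists V => //.
rewrite pE in colE; have [a af wa] := colon_witness uU colE.
apply/eqP; rewrite eqn_leq vmin /=; last exact: degP.
have <- : mdeg a = vnum (mideal U) by exact: (dhomogP _ _ _ fh).
exact: vnum_at_le.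
Qed.

End MonomialIdeals.

(** * Extension of monomial ideals to disjoint variables *)

Section SumOfMonomialIdeals.
Variables (K : fieldType) (n m : nat).
Implicit Types (U : set 'X_{1..n}) (T : set 'X_{1..m}).

Lemma inclAX (a : 'X_{1..n}) :
  inclA m 'X_[a] = 'X_[join_exp a 0%MM] :> {mpoly K[n + m]}.
Proof.
rewrite /inclA comp_mpolyX mpolyXE_id big_split_ord /= [X in _ * X]big1 ?mulr1.
  apply: eq_bigr => i _; rewrite tnth_mktuple mnmE.
  by rewrite (unsplitK (inl _ i)).
by move=> j _; rewrite mnmE (unsplitK (inr _ j)) mnm0E expr0.
Qed.

Lemma inclBX (b : 'X_{1..m}) :
  inclB n 'X_[b] = 'X_[join_exp 0%MM b] :> {mpoly K[n + m]}.
Proof.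
rewrite /inclB comp_mpolyX mpolyXE_id big_split_ord /= [X in X * _]big1 ?mul1r.
  apply: eq_bigr => i _; rewrite tnth_mktuple mnmE.
  by rewrite (unsplitK (inr _ i)).
by move=> j _; rewrite mnmE (unsplitK (inl _ j)) mnm0E expr0.
Qed.

Lemma comp_mideal (r : nat) (X : set 'X_{1..r}) (E : set {mpoly K[n + m]})
    (t : r.-tuple {mpoly K[n + m]}) (f : {mpoly K[r]}) :
  is_ideal E -> (forall a, X a -> E ('X_[a] \mPo t)) -> mideal X f -> E (f \mPo t).
Proof.
move=> iE XE Xf; rewrite comp_mpolyEX; apply: ideal_sum => // a af _.
by case: iE => _ _ _ mulE; rewrite -mul_mpolyC; apply/mulE/XE/Xf.
Qed.

Lemma sum_ext_mideal U T : upset U -> upset T ->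
  sum_ext (mideal U) (mideal T) = mideal (sum_exp U T) :> set {mpoly K[n + m]}.
Proof.
move=> uU uT; have iS := mideal_ideal K (sum_exp_up uU uT).
apply/seteqP; split=> [_ [f [g [If Jg ->]]]|f Sf].
  have [_ _ addS _] := iS; apply: addS.
    apply: If; split=> // _ [u Uu <-]; apply: comp_mideal Uu => // a Ua.
    by rewrite [_ \mPo _]inclAX; apply/midealX; left; rewrite lexp_join.
  apply: Jg; split=> // _ [u Tu <-]; apply: comp_mideal Tu => // b Tb.
  by rewrite [_ \mPo _]inclBX; apply/midealX; right; rewrite rexp_join.
pose inU : pred 'X_{1..n + m} := fun x => `[< U (lexp x) >].
have split_exp (x : 'X_{1..n + m}) :
    x = (join_exp (lexp x) 0 + join_exp 0 (rexp x))%MM.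
  by apply: exp_eqP; rewrite ?lexpD ?rexpD !(lexp_join, rexp_join) ?addm0 ?add0m.
exists (mpart inU f), (mpart (predC inU) f); split; last exact: mpartC.
  suff: mideal [set x | U (lexp x)] (mpart inU f).
    apply: mideal_min; first exact: ideal_gen_ideal.
    move=> x Ux E [[_ _ _ mulE] IE]; rewrite (split_exp x) mpolyXD mulrC.
    by apply: mulE => //; apply: IE; exists 'X_[lexp x]; rewrite ?midealX ?inclAX.
  by move=> x; rewrite msupp_part => /andP[/asboolP].
suff: mideal [set x | T (rexp x)] (mpart (predC inU) f).
  apply: mideal_min; first exact: ideal_gen_ideal.
  move=> x Tx E [[_ _ _ mulE] JE]; rewrite (split_exp x) mpolyXD.
  by apply: mulE => //; apply: JE; exists 'X_[rexp x]; rewrite ?midealX ?inclBX.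
move=> x; rewrite msupp_part => /andP[/= /negP nU /Sf[Ux|//]].
by case: nU; apply/asboolP.
Qed.

Lemma sum_ext_vars (V : {set 'I_n}) (W : {set 'I_m}) :
  sum_ext (mideal (vars_upset V)) (mideal (vars_upset W)) =
  mideal (vars_upset (join_vars V W)) :> set {mpoly K[n + m]}.
Proof.
by rewrite sum_ext_mideal ?vars_upset_join //; apply: vars_upset_up.
Qed.

End SumOfMonomialIdeals.

(** * v-numbers of symbolic powers of sums *)

Section SymbolicPowersOfSums.
Variables (K : fieldType) (n m : nat) (c : symb_kind).
Variables (U : set 'X_{1..n}) (T : set 'X_{1..m}).
Hypotheses (uU : upset U) (uT : upset T) (Unz : U !=set0) (Tnz : T !=set0).

Let I : set {mpoly K[n]} := mideal U.
Let J : set {mpoly K[m]} := mideal T.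
Let vI h (V : {set 'I_n}) := vnum_at (symb_pow c I h) (mideal (vars_upset V)).
Let vJ h (W : {set 'I_m}) := vnum_at (symb_pow c J h) (mideal (vars_upset W)).
Let vIJ h (V : {set 'I_n}) (W : {set 'I_m}) :=
  vnum_at (symb_pow c (sum_ext I J) h) (mideal (vars_upset (join_vars V W))).

Let symb_sum h : symb_pow c (sum_ext I J) h =
  mideal (sum_filtration (symb_exp c U) (symb_exp c T) h).
Proof.
rewrite sum_ext_mideal // symb_pow_mideal ?symb_exp_sum //.
exact: sum_exp_up.
Qed.

Let uSU h : upset (symb_exp c U h). Proof. exact: symb_exp_up. Qed.
Let uST h : upset (symb_exp c T h). Proof. exact: symb_exp_up. Qed.
Let uS h : upset (sum_filtration (symb_exp c U) (symb_exp c T) h).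
Proof. by rewrite -symb_exp_sum //; apply: symb_exp_up; apply: sum_exp_up. Qed.

Lemma vnum_at_sum_le i j V W :
  ass_vars (symb_exp c U i.+1) V -> ass_vars (symb_exp c T j.+1) W ->
  (vIJ (i + j).+1 V W <= vI i.+1 V + vJ j.+1 W)%N.
Proof.
rewrite /vIJ /vI /vJ symb_sum !symb_pow_mideal // => aV aW.
have [[a wa <-] [b wb <-]] := (vnum_atP K (@uSU _) aV, vnum_atP K (@uST _) aW).
have <- : mdeg (join_exp a b) = (mdeg a + mdeg b)%N.
  by rewrite mdeg_join lexp_join rexp_join.
apply: vnum_at_le => //; apply: witness_join => //.
- by move=> h h'; apply: symb_exp_le.
- by move=> h h'; apply: symb_exp_le.
- by move=> h; apply: symb_exp_nonempty.
- by move=> h; apply: symb_exp_nonempty.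
- by move=> h l d; apply: symb_exp_deriv.
- by move=> h l d; apply: symb_exp_deriv.
Qed.

Lemma vnum_at_sum_ge k V W :
  ass_vars (sum_filtration (symb_exp c U) (symb_exp c T) k.+1) (join_vars V W) ->
  exists i j, [/\ (i + j)%N = k, ass_vars (symb_exp c U i.+1) V,
    ass_vars (symb_exp c T j.+1) W
    & (vI i.+1 V + vJ j.+1 W <= vIJ k.+1 V W)%N].
Proof.
rewrite /vIJ symb_sum => /(vnum_atP K (@uS _))[x wx <-].
have [||||i [j [ijk wl wr]]] :=
  witness_split uSU (symb_exp0 c U) (symb_exp0 c T) _ _ _ _ wx.
- by move=> h h'; apply: symb_exp_le.
- by move=> h h'; apply: symb_exp_le.
- by move=> h; apply: symb_exp_nonempty.
- by move=> h l d; apply: symb_exp_deriv.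
exists i, j; split=> //; [by exists (lexp x)|by exists (rexp x)|].
by rewrite /vI /vJ !symb_pow_mideal // mdeg_join leq_add ?vnum_at_le.
Qed.

Lemma Ass_symb_sum h V W :
  Ass (symb_pow c (sum_ext I J) h) (mideal (vars_upset (join_vars V W))) <->
  ass_vars (sum_filtration (symb_exp c U) (symb_exp c T) h) (join_vars V W).
Proof. by rewrite symb_sum; apply: Ass_vars. Qed.

Lemma vnum_at_sum k V W :
  Ass (symb_pow c (sum_ext I J) k.+1) (mideal (vars_upset (join_vars V W))) ->
  is_minimum [set v | exists d, [/\ (d < k.+1)%N,
      Ass (symb_pow c I (k.+1 - d)) (mideal (vars_upset V)),
      Ass (symb_pow c J d.+1) (mideal (vars_upset W))
      & v = (vI (k.+1 - d) V + vJ d.+1 W)%N]]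
    (vIJ k.+1 V W).
Proof.
move=> /Ass_symb_sum aVW.
have lb d : (d < k.+1)%N ->
    ass_vars (symb_exp c U (k.+1 - d)) V -> ass_vars (symb_exp c T d.+1) W ->
    (vIJ k.+1 V W <= vI (k.+1 - d) V + vJ d.+1 W)%N.
  rewrite ltnS => dk; rewrite subSn // => aV aW.
  by have := vnum_at_sum_le aV aW; rewrite subnK.
split; last first.
  move=> _ [d [dk /(Ass_symb _ _ _ _ uU) aV /(Ass_symb _ _ _ _ uT) aW ->]].
  exact: lb.
have [i [j [ijk aV aW le]]] := vnum_at_sum_ge aVW.
have iE : (k.+1 - j)%N = i.+1 by rewrite -ijk -addSn addnK.
have jk : (j < k.+1)%N by rewrite ltnS -ijk leq_addl.
exists j; rewrite iE; split=> //; [exact/Ass_symb|exact/Ass_symb|].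
by apply/eqP; rewrite eqn_leq le andbT -iE lb // iE.
Qed.

End SymbolicPowersOfSums.

Theorem corollary2p5 (K : fieldType) (n m : nat)
    (I : set {mpoly K[n]}) (J : set {mpoly K[m]})
    (Imon : is_monomial_ideal I) (Jmon : is_monomial_ideal J)
    (Iproper : is_proper I) (Jproper : is_proper J)
    (Inz : I <> [set 0]) (Jnz : J <> [set 0])
    (k : nat) (k_ge1 : (1 <= k)%N) (c : symb_kind) :
  (forall (p : set {mpoly K[n]}) (q : set {mpoly K[m]}),
     is_monomial_ideal p -> is_prime p ->
     is_monomial_ideal q -> is_prime q ->
     Ass (symb_pow c (sum_ext I J) k) (sum_ext p q) ->
     is_minimum
       [set v : nat | exists d : nat,
          [/\ (d < k)%N,
              Ass (symb_pow c I (k - d)) p,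
              Ass (symb_pow c J d.+1) q
            & v = (vnum_at (symb_pow c I (k - d)) p
                   + vnum_at (symb_pow c J d.+1) q)%N]]
       (vnum_at (symb_pow c (sum_ext I J) k) (sum_ext p q)))
  /\
  is_minimum
    [set v : nat |
       exists (d : nat) (p : set {mpoly K[n]}) (q : set {mpoly K[m]}),
         [/\ (d < k)%N,
             Ass (symb_pow c I (k - d)) p,
             Ass (symb_pow c J d.+1) q,
             Ass (symb_pow c (sum_ext I J) k) (sum_ext p q)
           & v = (vnum_at (symb_pow c I (k - d)) p
                  + vnum_at (symb_pow c J d.+1) q)%N]]
    (vnum (symb_pow c (sum_ext I J) k)).
Proof.
have [U uU IE] := (monomial_idealP I).1 Imon.
have [T uT JE] := (monomial_idealP J).1 Jmon.
case: Iproper Jproper => _ I1 [_ J1]; case: k k_ge1 => [//|{}k _].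
rewrite {}IE in Inz I1 *; rewrite {}JE in Jnz J1 *.
have [Unz Tnz] := (mideal_nonzero Inz, mideal_nonzero Jnz).
have [U0 T0] := (mideal_proper I1, mideal_proper J1).
split.
  move=> p q pmon pprime qmon qprime.
  rewrite (monomial_primeP pmon pprime) (monomial_primeP qmon qprime).
  by rewrite sum_ext_vars => /(vnum_at_sum uU uT Unz Tnz).
set S := sum_exp U T; have uS : upset S by apply: sum_exp_up.
have S0 : ~ S 0%MM by rewrite /S /sum_exp /= lexp0 rexp0 => -[].
have uSk : upset (symb_exp c S k.+1) by apply: symb_exp_up.
have [[X aX vE] vmin] := vnum_min K uSk
  (symb_vars_exists SymbAss uSk (symb_exp_proper uS S0)).
have [V [W XE]] := join_varsP X; rewrite {}XE in aX vE.
have SE : sum_ext (mideal U) (mideal T) = mideal S :> set {mpoly K[n + m]}.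
  exact: sum_ext_mideal.
rewrite -symb_pow_mideal // -SE in vE vmin; rewrite vE.
split.
  have := aX; rewrite -(Ass_symb K) // -SE => aVW.
  have [[d [dk aV aW vdE]] _] := vnum_at_sum uU uT Unz Tnz aVW.
  by exists d, (mideal (vars_upset V)), (mideal (vars_upset W)); rewrite sum_ext_vars.
move=> _ [d [p [q [dk pA qA pqA ->]]]].
have [P pE] := Ass_symb_monomial uU pA; have [R qE] := Ass_symb_monomial uT qA.
subst p q; rewrite sum_ext_vars in pqA.
have [_ PRmin] := vnum_at_sum uU uT Unz Tnz pqA.
apply: leq_trans (PRmin _ _); last by exists d.
rewrite -vE; apply: vmin; exists (join_vars P R) => //.
by rewrite -(Ass_symb K) // -SE.
Qed.
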